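(* Every locally finite group is an LEF group. Every abelian group is an LEF group.
   Context: Let $A$ be a subset of a group $G$ and let $H$ be a group. A partial homomorphism from $A$ to $H$ is a function $f : A \to H$ such that, for all $a, b \in A$ with $ab \in A$, one has $f(ab) = f(a) f(b)$. A local embedding is a one-to-one partial homomorphism. A group $G$ is locally embeddable into finite groups, or an LEF group, if for every finite subset $A$ of $G$ there exist a finite group $H$ and a local embedding $f : A \to H$. A group is locally finite if every finite subset of it generates a finite subgroup. *)

(* Defs.v *)
From mathcomp Require Import all_boot all_order all_fingroup.
From mathcomp Require Import all_classical.

Set Implicit Arguments.
Unset Strict Implicit.
Unset Printing Implicit Defensive.

Local Open Scope classical_set_scope.
Local Open Scope group_scope.

(* A map A -> H is represented by a total map G -> H of which only the
   restriction to A matters; since H is nonempty, every map A -> H extends. *)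
Definition partial_hom (G H : groupType) (A : set G) (f : G -> H) : Prop :=
  {in A &, forall a b, a * b \in A -> f (a * b) = f a * f b}.

Definition local_embedding (G H : groupType) (A : set G) (f : G -> H) : Prop :=
  partial_hom A f /\ {in A &, injective f}.

Definition lef (G : groupType) : Prop :=
  forall A : set G, finite_set A ->
    exists (H : finGroupType) (f : G -> H), local_embedding A f.

Definition subgroup_generated (G : groupType) (A : set G) : set G :=
  smallest [set B : set G | group_closed (mem B)] A.

Definition locally_finite (G : groupType) : Prop :=
  forall A : set G, finite_set A -> finite_set (subgroup_generated A).

Definition abelian_group (G : groupType) : Prop :=
  forall x y : G, commute x y.

(* Main.v *)
(** A finite subset of a locally finite group lies in a finite subgroup,
    which acts on itself by right translations; these permutations give the
    local embedding.

    For an abelian group and a finite subset [s], let [n = size s] and consider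
    the lattice in [Z^n] spanned by the finitely many relations
    [delta (a + b) - (delta a + delta b)] with [a], [b] and [a + b] in [s].
    By the Smith normal form, its quotient is, up to a change of basis, a
    product of cyclic groups, so finitely many vectors outside the lattice
    survive in a finite quotient.  Evaluation in the group kills the lattice,
    hence [delta a - delta b] is outside it when [a <> b]. *)

Require Import Defs.
From mathcomp Require Import all_boot all_order all_fingroup.
From mathcomp Require Import ssralg ssrint intdiv zmodp matrix.
From mathcomp Require Import all_classical.
From HB Require Import structures.

Set Implicit Arguments.
Unset Strict Implicit.
Unset Printing Implicit Defensive.

Import GRing.Theory.

Lemma locally_finite_lef (G : groupType) : locally_finite G -> lef G.
Proof.
move=> Gfin A Afin.
have [s sE] := (finite_seqP _).1 (Gfin A Afin).
have inB x : subgroup_generated A x <-> x \in s by rewrite sE.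
have sgP : group_closed (mem s).
  split; first by apply/inB => B [[B1 _] _]; exact: set_mem B1.
  move=> x y /inB xB /inB yB; apply/inB => B BA.
  exact: set_mem (BA.1.2 _ _ (mem_set (xB B BA)) (mem_set (yB B BA))).
have As a : a \in A -> a \in s.
  by rewrite inE => Aa; apply/inB; apply: sub_gen_smallest.
have one_s : 1%g \in s by case: sgP.
pose X := seq_sub s; pose one : X := SeqSub one_s.
(* The defaults [one] here and the identity permutation in [f] are only reached for [g] outside
   [s]. *)
pose shift (g : G) : {ffun X -> X} := [ffun x => insubd one (val x * g)%g].
pose f (g : G) : {perm X} := insubd (1%g : {perm X}) (shift g).
have shiftE g x : g \in s -> val (shift g x) = (val x * g)%g.
  move=> gs; rewrite ffunE insubdK //.
  by apply: (group_closedM sgP) => //; apply: valP.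
have fE g x : g \in s -> val (f g x) = (val x * g)%g.
  move=> gs; rewrite -shiftE //; congr val.
  rewrite -[f g]/(insubd _ _) -pvalE [pval _]insubdK //.
  apply/injectiveP => y z yz.
  by apply/val_inj/(mulIg g); rewrite -!shiftE // yz.
exists {perm X}, f; split=> [a b /As aA /As bA /As abA | a b /As aA /As bA fab].
  by apply/permP => x; apply: val_inj; rewrite permM !fE // mulgA.
(* A translation is determined by the image of the identity. *)
by have := fE a one aA; rewrite fab fE //= !mul1g.
Qed.

Local Open Scope ring_scope.

(** For [N] at most 1, the type ['Z_N] still has two elements, hence the bound. *)
Lemma intr_Zp_eq0 (N : nat) (z : int) : (1 < N)%N ->
  (z%:~R == 0 :> 'Z_N) = (N %| z)%Z.
Proof.
move=> N1.
have nE (k : nat) : (k%:R == 0 :> 'Z_N) = (N %| k)%N.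
  by rewrite -val_eqE /= val_Zp_nat.
by case: z => k; rewrite ?NegzE ?rmorphN ?oppr_eq0 ?dvdzN; exact: nE.
Qed.

(** This replaces the cyclic factors by a single [Z / N]; a free factor, where [e j = 0], is
    separated only on integers smaller than [B] in absolute value. *)
Lemma common_modulus n (e : 'I_n -> int) (B : nat) :
  exists (N : nat) (c : 'I_n -> int), [/\ (1 < N)%N,
    forall j, (N %| e j * c j)%Z &
    forall j (x : int), (`|x| < B)%N -> (N %| x * c j)%Z -> (e j %| x)%Z].
Proof.
pose P := (\prod_(j < n | e j != 0) `|e j|)%N.
(* Every nonzero [e j] divides [P], and [B.+2] makes [N] exceed both 1 and [B]. *)
pose N := (P * B.+2)%N.
have P0 : (0 < P)%N by apply: prodn_cond_gt0 => j; rewrite absz_gt0.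
have BN : (B.+2 <= N)%N by rewrite leq_pmull.
have eN j : e j != 0 -> (e j %| N%:Z)%Z.
  by move=> ej0; rewrite dvdzE /= /N /P (bigD1 j) //= -mulnA dvdn_mulr.
(* [Z / e j] embeds into [Z / N] by [x |-> x * (N / e j)]. *)
exists N, (fun j => if e j == 0 then 1 else (N %/ e j)%Z); split.
- exact: leq_trans BN.
- move=> j; case: eqP => [->|/eqP ej]; first by rewrite mul0r dvdz0.
  by rewrite mulrC divzK ?eN.
- move=> j x xB; case: eqP => [-> | /eqP ej].
    rewrite mulr1 dvd0z dvdzE /= => Nx; rewrite -absz_eq0.
    case: posnP => // x0; have := dvdn_leq x0 Nx.
    by rewrite leqNgt (leq_trans xB) // (leq_trans _ BN) // ltnW.
  set q := (N %/ e j)%Z => Nx.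
  have NE : Posz N = q * e j by rewrite divzK ?eN.
  have q0 : q != 0.
    by apply/eqP => q0; move: NE BN; rewrite q0 mul0r => -[->].
  by move: Nx; rewrite NE mulrC dvdz_mul2l.
Qed.

Lemma int_lattice_separation m n (M : 'M[int]_(m, n)) (vs : seq 'rV[int]_n) :
  exists (N k : nat) (phi : {additive 'rV[int]_n -> 'rV['Z_N]_k}),
    (forall i, phi (row i M) = 0) /\
    {in vs, forall v, phi v = 0 -> exists w, v = w *m M}.
Proof.
have [L uL [R uR [d _ ME]]] := int_Smith_normal_form M.
set D := (\matrix_(i, j) _) in ME.
(* The columns beyond the last row of [D] are the free coordinates of the
   quotient: they get the modulus 0. *)
pose e (j : 'I_n) : int := if (j < m)%N then d`_j else 0.
(* In these coordinates the row lattice of [M] becomes that of [D], where membership means that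
   [e j] divides coordinate [j] for all [j]. *)
pose x (v : 'rV[int]_n) := v *m invmx R.
pose B := (\sum_(v <- vs) \sum_(j < n) `|x v 0%R j|.+1)%N.
have [N [c [N1 ec cP]]] := common_modulus e B.
pose phi (v : 'rV[int]_n) : 'rV['Z_N]_n := \row_j (x v 0 j * c j)%:~R.
have phiE v j : phi v 0 j = (x v 0 j * c j)%:~R by rewrite [LHS]mxE.
have phiB : zmod_morphism phi.
  move=> u v; apply/rowP => j.
  rewrite phiE /x mulmxBl [in LHS]mxE [X in _ + X]mxE mulrBl rmorphB.
  by rewrite [RHS]mxE [X in _ = _ + X]mxE !phiE.
pose phiA := GRing.isZmodMorphism.Build _ _ phi phiB.
pose phiM : {additive 'rV[int]_n -> 'rV['Z_N]_n} := HB.pack phi phiA.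
exists N, n, phiM; split=> [i | v vvs /rowP pv0] /=.
  apply/rowP => j; rewrite phiE [RHS]mxE; apply/eqP; rewrite intr_Zp_eq0 //.
  apply: dvdz_trans (ec j) _; apply: dvdz_mul => //.
  rewrite /x ME !row_mul mulmxK // mxE rpred_sum // => i' _.
  rewrite !mxE; case: eqP => [ij|_]; last by rewrite mulr0n mulr0 dvdz0.
  by rewrite /e -ij ltn_ord mulr1n dvdz_mull.
have xe j : (e j %| x v 0%R j)%Z.
  apply: cP.
    by rewrite /B (big_rem v) //= (bigD1 j) //= -addnA ltn_addr.
  by rewrite -intr_Zp_eq0 // -phiE pv0 mxE.
(* Dividing the coordinates by the diagonal of [D] solves [u *m D = x v]; rows of [D] beyond the
   last column get 0. *)
pose u : 'rV[int]_m :=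
  \row_i (if insub (i : nat) is Some j then (x v 0%R j %/ e j)%Z else 0).
exists (u *m invmx L).
rewrite ME !mulmxA mulmxKV //.
suff -> : u *m D = x v by rewrite mulmxKV.
apply/rowP => j; rewrite mxE.
have [jm | mj] := ltnP j m.
  rewrite (bigD1 (Ordinal jm)) //= big1 => [|i ij].
    rewrite addr0 [u _ _]mxE [D _ _]mxE eqxx mulr1n /= valK.
    by have := xe j; rewrite /e jm; apply: divzK.
  rewrite !mxE; case: eqP => [ji|_]; last by rewrite mulr0n mulr0.
  by case/eqP: ij; apply: val_inj.
rewrite big1 => [|i _].
  by have := xe j; rewrite /e ltnNge mj /= dvd0z => /eqP.
rewrite !mxE; case: eqP => [ij|_]; last by rewrite mulr0n mulr0.
by move: (ltn_ord i); rewrite ij ltnNge mj.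
Qed.

Lemma zmod_local_embedding (V : zmodType) (s : seq V) :
  exists (N k : nat) (f : V -> 'rV['Z_N]_k),
    {in s &, forall a b, a + b \in s -> f (a + b) = f a + f b} /\
    {in s &, injective f}.
Proof.
pose n := size s.
pose delta (x : V) : 'rV[int]_n := \row_j (j == index x s :> nat)%:R.
pose ev (v : 'rV[int]_n) : V := \sum_(j < n) s`_j *~ v 0 j.
have evD u v : ev (u + v) = ev u + ev v.
  by rewrite -big_split; apply: eq_bigr => j _; rewrite mxE mulrzDr.
have evZ z v : ev (z *: v) = ev v *~ z.
  rewrite /ev mulrz_suml; apply: eq_bigr => j _.
  by rewrite mxE mulrC mulrzA.
have evN v : ev (- v) = - ev v by rewrite -scaleN1r evZ mulrN1z.
have evdelta x : x \in s -> ev (delta x) = x.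
  rewrite -index_mem => xs.
  rewrite /ev (bigD1 (Ordinal xs)) //= big1 => [|j jx].
    by rewrite mxE eqxx addr0 mulr1z nth_index // -index_mem.
  rewrite mxE; case: eqP => // ji.
  by case/eqP: jx; apply: val_inj.
pose rel (t : 'I_n * 'I_n) : 'rV[int]_n :=
  if s`_t.1 + s`_t.2 \in s
  then delta (s`_t.1 + s`_t.2) - (delta s`_t.1 + delta s`_t.2) else 0.
have evrel t : ev (rel t) = 0.
  rewrite /rel; case: ifP => ts; last by rewrite -[0](scale0r 0) evZ mulr0z.
  by rewrite evD evN evD !evdelta ?mem_nth // subrr.
pose M : 'M[int]_(#|{: 'I_n * 'I_n}|, n) := \matrix_t rel (enum_val t).
have evM w : ev (w *m M) = 0.
  rewrite mulmx_sum_row (big_ind (fun v => ev v = 0)) //.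
  - by rewrite -[0](scale0r 0) evZ mulr0z.
  - by move=> u v u0 v0; rewrite evD u0 v0 addr0.
  by move=> t _; rewrite evZ rowK evrel mul0rz.
have [N [k [phi [phiM phiI]]]] :=
  int_lattice_separation M [seq delta a - delta b | a <- s, b <- s].
exists N, k, (phi \o delta); split=> [a b aS bS abS | a b aS bS /= ab].
  apply/eqP; rewrite /= -raddfD -subr_eq0 -raddfB /=.
  have ia : (index a s < n)%N by rewrite index_mem.
  have ib : (index b s < n)%N by rewrite index_mem.
  have := phiM (enum_rank (Ordinal ia, Ordinal ib)).
  by rewrite rowK enum_rankK /rel /= !nth_index // abS => ->.
(* If [a] and [b] have equal images, the difference lies in the lattice, so [ev] sends it to both
   [a - b] and 0. *)
have [|| w wM] := phiI (delta a - delta b).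
- by apply/allpairsP; exists (a, b).
- by rewrite raddfB ab subrr.
apply/eqP; rewrite -subr_eq0 -{1}(evdelta a) // -(evdelta b) //.
by rewrite -evN -evD wM evM.
Qed.

(** The phantom argument carries the commutativity proof that the additive structure on this alias
    requires. *)
Definition additive_copy (G : groupType) (_ : abelian_group G) : Type := G.

Section AdditiveCopy.
Variables (G : groupType) (cG : abelian_group G).

HB.instance Definition _ := Choice.on (additive_copy cG).
HB.instance Definition _ := GRing.isZmodule.Build (additive_copy cG)
  (@mulgA G) cG (@mul1g G) (@mulVg G).

End AdditiveCopy.

Lemma abelian_lef (G : groupType) : abelian_group G -> lef G.
Proof.
move=> cG A /finite_seqP[s ->].
have [N [k [f [fM fI]]]] := @zmod_local_embedding (additive_copy cG) s.
exists 'rV['Z_N]_k, f; split=> a b; rewrite !mem_setE; first exact: fM.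
exact: fI.
Qed.

Theorem theorem1 :
  (forall G : groupType, locally_finite G -> lef G) /\
  (forall G : groupType, abelian_group G -> lef G).
Proof. by split; [exact: locally_finite_lef | exact: abelian_lef]. Qed.
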